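(* Let $G$ be a finite non-cyclic group. Let $a, b \in G$ be distinct elements such that $a \nsim b$ in $\mathscr{P}(G)$ and $N_a = N_b = k$. Then the following statements are equivalent: (1) $a \sim b$ in $\mathscr{P}_e(G)$; (2) there exists $c \in G$ such that $a \sim c$ and $b \sim c$ in $\mathscr{P}(G)$ and $N_c > k$.
   Context: For a group $G$, the power graph $\mathscr{P}(G)$ is the simple graph with vertex set $G$ in which two distinct vertices $a,b$ are adjacent if and only if $\langle a\rangle \subseteq \langle b\rangle$ or $\langle b\rangle \subseteq \langle a\rangle$. The enhanced power graph $\mathscr{P}_e(G)$ is the simple graph with vertex set $G$ in which two distinct vertices $a,b$ are adjacent if and only if there exists $c \in G$ with $a,b \in \langle c\rangle$. The notation $a\sim b$ means that $a$ and $b$ are adjacent in the indicated graph, and $a \nsim b$ that they are not. For $a \in G$, $N(a)$ denotes the set of neighbors of $a$ in $\mathscr{P}(G)$ (so $a\notin N(a)$), $\widetilde{N(a)} = \{b \in N(a) \mid N(a)\setminus\{b\} = N(b)\setminus\{a\}\}$ is the set of closed twins of $a$, and $N_a = |\widetilde{N(a)}| + 1$. *)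

(* Defs.v *)
From mathcomp Require Import all_boot all_fingroup all_solvable.

Set Implicit Arguments.
Unset Strict Implicit.
Unset Printing Implicit Defensive.

Local Open Scope group_scope.

(* Simple graphs with vertex set the finite group G are encoded as symmetric
   irreflexive relations on the ambient type gT, false outside G. *)

Definition power_graph (gT : finGroupType) (G : {group gT}) : rel gT :=
  fun a b => [&& a \in G, b \in G, a != b &
                 (<[a]> \subset <[b]>) || (<[b]> \subset <[a]>)].

Definition enhanced_power_graph (gT : finGroupType) (G : {group gT}) : rel gT :=
  fun a b => [&& a \in G, b \in G, a != b &
                 [exists c in G, (a \in <[c]>) && (b \in <[c]>)]].

Definition neighbors (gT : finGroupType) (G : {group gT}) (a : gT) : {set gT} :=
  [set b | power_graph G a b].

Definition closed_twins (gT : finGroupType) (G : {group gT}) (a : gT) :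
    {set gT} :=
  [set b in neighbors G a | neighbors G a :\ b == neighbors G b :\ a].

(* N_a in the literature: the number of closed twins of a, plus one for a. *)
Definition twin_number (gT : finGroupType) (G : {group gT}) (a : gT) : nat :=
  #|closed_twins G a|.+1.

(* Main.v *)
(* Call two elements comparable when one of the cyclic subgroups they generate
   contains the other.  Two closed twins [x] and [y] with [<x>] contained in
   [<y>] generate the same subgroup as soon as [x] lies in a common cyclic
   subgroup with some [b] comparable to neither: [<x><b>] is cyclic, hence
   comparable to [<y>], so it contains [<y>], and Dedekind's law gives
   [<y> = <x>(<b> :&: <y>)], where the second factor is comparable to [<x>].

   If [a] and [b] lie in a common cyclic subgroup, the twin classes of [a] and
   [b] therefore consist of generators, so that [k = phi #[a] = phi #[b]], while
   the generator [c] of [<a><b>] has [N_c >= phi #[c] > k]: equality would force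
   [#[a]] and [#[b]] to be odd and [#[c]] to be even.

   Conversely, if [c] lies in [<a> :&: <b>] but [a] and [b] are in no common
   cyclic subgroup, the twin class of [c] lies in [<x>] for one of its members
   [x], and [<x>] is a proper subgroup of [<a>].  If that class does not consist
   of generators of [<x>], the first observation makes [x] comparable to all of
   [<a>]; then [#[a]] is a power of a prime [p] and
   [N_c <= #[x] <= #[a] / p <= phi #[a] <= N_a]. *)
Require Import Defs.
From mathcomp Require Import all_boot all_fingroup all_solvable.

Set Implicit Arguments.
Unset Strict Implicit.
Unset Printing Implicit Defensive.

(** * Euler's totient along divisibility *)

Lemma totient_mul_prime (p d : nat) : prime p -> 0 < d ->
  totient (d * p) = totient d * (if p %| d then p else p.-1).
Proof.
move=> p_pr d_gt0; have [m pm ->] := pfactor_coprime p_pr d_gt0.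
have cop n : coprime m (p ^ n) by rewrite coprime_sym coprimeXl.
rewrite -mulnA -expnSr !totient_coprime //.
case: (logn p d) => [|v].
  rewrite expn0 expn1 (totient_prime p_pr) !muln1.
  by move: pm; rewrite prime_coprime // => /negPf->.
by rewrite !totient_pfactor // dvdn_mull ?dvdn_exp //= expnSr !mulnA.
Qed.

Lemma leq_totient_dvd (d n : nat) : 0 < n -> d %| n -> totient d <= totient n.
Proof.
move=> n_gt0 /dvdnP[m def_n]; move: n_gt0; rewrite {n}def_n mulnC.
elim/ltn_ind: m => m IHm; rewrite muln_gt0 => /andP[d_gt0 m_gt0].
have [->|m_neq1] := eqVneq m 1%N; first by rewrite muln1.
have m_gt1: 1 < m by rewrite ltn_neqAle eq_sym m_neq1.
have p_pr := pdiv_prime m_gt1; have /dvdnP[q def_m] := pdiv_dvd m.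
have q_gt0: 0 < q by move: m_gt0; rewrite {1}def_m muln_gt0 => /andP[].
have dq_gt0: 0 < d * q by rewrite muln_gt0 d_gt0.
rewrite def_m mulnA totient_mul_prime //.
apply: leq_trans (IHm q _ dq_gt0) _.
  by rewrite [ltnRHS]def_m ltn_Pmulr // prime_gt1.
apply: leq_pmulr; case: ifP => _; first exact: prime_gt0.
by rewrite -subn1 subn_gt0 prime_gt1.
Qed.

(** For a prime [p] dividing [n %/ d], passing from [d] to [d * p] multiplies the totient by [p] or
    [p.-1]. The hypothesis leaves only the factor 1, so [p = 2] and [d] is odd. *)
Lemma totient_proper_dvd (d n : nat) : 0 < n -> d %| n -> d != n ->
  totient n <= totient d -> odd d && ~~ odd n.
Proof.
move=> n_gt0 d_n d_neq_n le_nd.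
have d_gt0 := dvdn_gt0 n_gt0 d_n.
have nd_gt1: 1 < n %/ d by rewrite ltn_divRL // mul1n ltn_neqAle d_neq_n dvdn_leq.
have p_pr := pdiv_prime nd_gt1; set p := pdiv _ in p_pr.
have dp_n: d * p %| n.
  by rewrite -(divnK d_n) mulnC dvdn_pmul2r // pdiv_dvd.
have := leq_trans (leq_totient_dvd n_gt0 dp_n) le_nd.
rewrite totient_mul_prime // -[leqRHS]muln1 leq_pmul2l ?totient_gt0 //.
have p_gt1 := prime_gt1 p_pr.
case: ifPn => [_|]; first by rewrite leqNgt p_gt1.
move=> p'd; rewrite -subn1 leq_subLR => p_le2.
have p2: p = 2 by apply/eqP; rewrite eqn_leq p_le2.
move: p'd; rewrite p2 dvdn2 negbK => ->.
by rewrite -dvdn2 -p2 (dvdn_trans _ dp_n) // dvdn_mull.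
Qed.

Local Open Scope group_scope.

(** * Comparability of cyclic subgroups and twin classes *)

Section TwinClasses.

Variable gT : finGroupType.
Implicit Types (G : {group gT}) (a b c x y z : gT).

Definition cyc_comparable x y := (<[x]> \subset <[y]>) || (<[y]> \subset <[x]>).

(** Equality of closed neighbourhoods in the power graph: as comparability is reflexive, [a] belongs
    to its own class, whose size is therefore N_a. *)
Definition twin_class G a :=
  [set y in G | [forall z in G, cyc_comparable a z == cyc_comparable y z]].

Lemma cyc_comparablexx x : cyc_comparable x x.
Proof. by rewrite /cyc_comparable subxx. Qed.

Lemma cyc_comparableC x y : cyc_comparable x y = cyc_comparable y x.
Proof. exact: orbC. Qed.

Lemma power_graphE G a b : a \in G -> b \in G ->
  power_graph G a b = (a != b) && cyc_comparable a b.
Proof. by rewrite /power_graph => -> ->. Qed.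

Lemma twin_classP G a y :
  reflect (y \in G /\ {in G, forall z, cyc_comparable a z = cyc_comparable y z})
          (y \in twin_class G a).
Proof.
rewrite inE; apply: (iffP andP) => -[yG tw]; split=> //.
  by move=> z zG; apply/eqP; move/forall_inP: tw; apply.
by apply/forall_inP=> z zG; rewrite tw.
Qed.

Lemma twin_class_refl G a : a \in G -> a \in twin_class G a.
Proof. by move=> aG; apply/twin_classP. Qed.

Lemma twin_classE G a : a \in G -> twin_class G a = a |: closed_twins G a.
Proof.
move=> aG; apply/setP=> y; rewrite in_setU1.
have [->|y_neq_a] /= := eqVneq y a; first exact: twin_class_refl.
apply/twin_classP/idP=> [[yG tw]|].
  have ay: cyc_comparable a y by rewrite tw ?cyc_comparablexx.
  rewrite !inE power_graphE // eq_sym y_neq_a ay /=.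
  apply/eqP/setP=> z; rewrite !inE.
  have [zG|z'G] := boolP (z \in G); last first.
    by rewrite /power_graph (negPf z'G) !andbF.
  rewrite !power_graphE // tw // [a == z]eq_sym [y == z]eq_sym.
  by rewrite andbCA.
rewrite !inE => /andP[/and4P[_ yG _ ay] /eqP/setP tw]; split=> // z zG.
have [-> | z_neq_a] := eqVneq z a.
  by rewrite cyc_comparablexx cyc_comparableC.
have [-> | z_neq_y] := eqVneq z y; first by rewrite cyc_comparablexx.
have:= tw z; rewrite !inE !power_graphE // z_neq_a z_neq_y.
by rewrite [a == z]eq_sym [y == z]eq_sym z_neq_a z_neq_y.
Qed.

Lemma twin_numberE G a : a \in G -> twin_number G a = #|twin_class G a|.
Proof.
move=> aG; rewrite twin_classE // cardsU1 /twin_number.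
by rewrite !inE /power_graph eqxx !andbF.
Qed.

Lemma totient_leq_twins G a : a \in G -> totient #[a] <= #|twin_class G a|.
Proof.
move=> aG; rewrite totient_gen; apply/subset_leq_card/subsetP=> y.
rewrite inE => /eqP aEy; apply/twin_classP; split=> [|z _].
  by rewrite -cycle_subG -aEy cycle_subG.
by rewrite /cyc_comparable aEy.
Qed.

Lemma twins_leq_totient G a x :
    {in twin_class G a, forall y, <[y]> = <[x]>} ->
  #|twin_class G a| <= totient #[x].
Proof.
move=> gen; rewrite totient_gen; apply/subset_leq_card/subsetP=> y /gen xEy.
by rewrite inE /generator xEy.
Qed.

Lemma nested_twins_cycle_eq G x y b c :
    x \in G -> y \in G -> b \in G ->
    {in G, forall z, cyc_comparable x z = cyc_comparable y z} ->
    <[x]> \subset <[y]> -> ~~ cyc_comparable x b ->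
    x \in <[c]> -> b \in <[c]> ->
  <[x]> = <[y]>.
Proof.
move=> xG yG bG tw sxy nxb xc bc.
have nyb: ~~ cyc_comparable y b by rewrite -tw.
have cXB: <[b]> \subset 'C(<[x]>).
  by rewrite (sub_abelian_cent2 (cycle_abelian c)) ?cycle_subG.
have [w defw]: exists w, <[x]> <*> <[b]> = <[w]>.
  apply/cyclicP; apply: cyclicS (cycle_cyclic c).
  by rewrite join_subG !cycle_subG xc.
have sxw: <[x]> \subset <[w]> by rewrite -defw joing_subl.
have sbw: <[b]> \subset <[w]> by rewrite -defw joing_subr.
have wG: w \in G by rewrite -cycle_subG -defw join_subG !cycle_subG xG.
(* As [w] is comparable to [x], it is comparable to the twin [y]; [<[w]>] inside [<[y]>] would put
   [b] in [<[y]>]. *)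
have: cyc_comparable y w by rewrite -tw // /cyc_comparable sxw.
case/orP=> [syw | swy]; last first.
  by case/negP: nyb; rewrite /cyc_comparable (subset_trans sbw swy) orbT.
have defY: <[x]> * (<[b]> :&: <[y]>) = <[y]>.
  by rewrite group_modl // -(cent_joinEr cXB) defw (setIidPr syw).
have [u defu]: exists u, <[b]> :&: <[y]> = <[u]>.
  by apply/cyclicP; apply: cyclicS (subsetIl _ _) (cycle_cyclic b).
have suy: <[u]> \subset <[y]> by rewrite -defu subsetIr.
have uG: u \in G by rewrite -cycle_subG (subset_trans suy) ?cycle_subG.
have: cyc_comparable x u by rewrite tw // /cyc_comparable suy orbT.
case/orP=> [sxu | sux].
  case/negP: nxb; rewrite /cyc_comparable (subset_trans sxu) //.
  by rewrite -defu subsetIl.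
by rewrite -defY defu mulGSid.
Qed.

Lemma twins_generate_cycle G a b c :
    a \in G -> b \in G -> ~~ cyc_comparable a b ->
    a \in <[c]> -> b \in <[c]> -> c \in G ->
  {in twin_class G a, forall y, <[y]> = <[a]>}.
Proof.
move=> aG bG nab ac bc cG y /twin_classP[yG tw].
have: cyc_comparable a y by rewrite tw ?cyc_comparablexx.
case/orP=> [say | sya].
  by apply/esym/(nested_twins_cycle_eq aG yG bG tw say nab ac bc).
(* Now [y] is the smaller twin: it inherits from [a] the incomparability with [b] and the membership
   in [<[c]>]. *)
apply: (nested_twins_cycle_eq yG aG bG _ sya _ _ bc) => [z zG||].
- by rewrite tw.
- by rewrite -tw.
by rewrite -cycle_subG (subset_trans sya) ?cycle_subG.
Qed.

(** As [p] divides [#[x]], the p'-part of [a] cannot lie above [x], so it lies in [<[x]>]. The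
    p-part then does not, hence lies above [x]; so [x] is a p-element and the p'-part is trivial. *)
Lemma dominated_cycle_pgroup a x :
    x != 1 -> a \notin <[x]> ->
    {in <[a]>, forall u, cyc_comparable x u} ->
  (pdiv #[x]).-elt a.
Proof.
move=> x_neq1 a'x dom; set p := pdiv _.
have x_gt1: 1 < #[x] by rewrite order_gt1.
have p_pr: prime p := pdiv_prime x_gt1.
have u_x: a.`_p^' \in <[x]>.
  have /orP[sxu | ] := dom _ (mem_cycle a _ : a.`_p^' \in _); last first.
    by rewrite cycle_subG.
  have: p^'.-elt x by apply: pgroupS sxu _; apply: p_elt_constt.
  by rewrite /p_elt p'natE // pdiv_dvd.
have v'x: a.`_p \notin <[x]>.
  by apply: contra a'x => vx; rewrite -(consttC p a) groupM.
have sxv: <[x]> \subset <[a.`_p]>.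
  have /orP[//| ] := dom _ (mem_cycle a _ : a.`_p \in _).
  by rewrite cycle_subG (negPf v'x).
have px: p.-elt x by apply: pgroupS sxv _; apply: p_elt_constt.
have u1: a.`_p^' = 1.
  apply/eqP; rewrite -order_eq1; apply/eqP.
  apply: (@pnat_1 p); last exact: p_elt_constt.
  by apply: mem_p_elt u_x.
by rewrite -(consttC p a) u1 mulg1 p_elt_constt.
Qed.

Lemma proper_pcycle_leq_totient (p : nat) a x : prime p -> p.-elt a ->
  x \in <[a]> -> a \notin <[x]> -> #[x] <= totient #[a].
Proof.
move=> p_pr /p_natP[n def_a] xa a'x.
have xa_dvd: #[x] %| #[a] by apply: order_dvdG.
have: #[x] != #[a].
  apply: contra a'x => /eqP eq_xa.
  suff /eqP->: <[x]> == <[a]> by apply: cycle_id.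
  by rewrite eqEcard cycle_subG xa -!orderE eq_xa /=.
move: xa_dvd; rewrite def_a => /(dvdn_pfactor _ _ p_pr)[m le_mn ->].
case: n def_a le_mn => [|n] _; first by rewrite leqn0 => /eqP->; rewrite eqxx.
rewrite leq_eqVlt => /predU1P[-> | lt_mn _]; first by rewrite eqxx.
(* With [m <= n], the chain is p^m <= p^n <= (p - 1) p^n. *)
rewrite totient_pfactor //= (@leq_trans (p ^ n)%N) //.
  by rewrite leq_exp2l ?prime_gt1.
by rewrite leq_pmull // -subn1 subn_gt0 prime_gt1.
Qed.

(** Twins are pairwise comparable, so their cyclic subgroups form a chain and a twin of maximal
    order generates the largest one. *)
Lemma exists_max_twin G c : c \in G ->
  exists2 x, x \in twin_class G c & twin_class G c \subset <[x]>.
Proof.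
move=> cG; have cT := twin_class_refl cG.
case: (@arg_maxnP _ c (mem (twin_class G c)) (fun x => #[x]) cT) => x xT maxx.
exists x => //; apply/subsetP=> y yT.
have [[xG twx] [yG twy]] := (twin_classP _ _ _ xT, twin_classP _ _ _ yT).
have: cyc_comparable x y by rewrite -twx // twy ?cyc_comparablexx.
case/orP=> [sxy|]; last by rewrite cycle_subG.
suff /eqP->: <[x]> == <[y]> by apply: cycle_id.
by rewrite eqEcard sxy; apply: maxx.
Qed.

Lemma twins_leq_of_no_common_cycle G a b c :
    a \in G -> b \in G -> c \in <[a]> -> c \in <[b]> ->
    ~~ cyc_comparable a b ->
    (forall d, d \in G -> ~~ ((a \in <[d]>) && (b \in <[d]>))) ->
  #|twin_class G c| <= #|twin_class G a|.
Proof.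
move=> aG bG ca cb nab no_d.
have cG: c \in G by apply: subsetP ca; rewrite cycle_subG.
have [x xT Tx] := exists_max_twin cG; have [xG twx] := twin_classP _ _ _ xT.
have: cyc_comparable x a by rewrite -twx // /cyc_comparable cycle_subG ca.
have: cyc_comparable x b by rewrite -twx // /cyc_comparable cycle_subG cb.
rewrite /cyc_comparable => xb xa.
(* Otherwise [x] being comparable to [b] gives either [<[a]>] inside [<[b]>], or [x] as a common
   cyclic overgroup. *)
have a'x: a \notin <[x]>.
  apply/negP=> ax; case/orP: xb => [sxb | sbx].
    case/negP: nab; rewrite /cyc_comparable (subset_trans _ sxb) //.
    by rewrite cycle_subG.
  by have /negP[] := no_d x xG; rewrite ax -cycle_subG.
have {xb} {}xa: x \in <[a]>.
  by move: xa; rewrite !cycle_subG (negPf a'x) orbF.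
apply: leq_trans (totient_leq_twins aG).
have [/forall_inP gen | ] := boolP [forall y in twin_class G c, <[y]> == <[x]>].
  apply: leq_trans (leq_totient_dvd (order_gt0 a) (order_dvdG xa)).
  by apply: twins_leq_totient => y /gen/eqP.
rewrite negb_forall_in => /exists_inP[y yT y_neq_x].
have [yG twy] := twin_classP _ _ _ yT; have yx := subsetP Tx y yT.
have syx: <[y]> \subset <[x]> by rewrite cycle_subG.
have tw: {in G, forall z, cyc_comparable y z = cyc_comparable x z}.
  by move=> z zG; rewrite -twx // twy.
have x_neq1: x != 1.
  apply: contra y_neq_x => /eqP x1; move: yx.
  by rewrite x1 cycle1 => /set1P->; rewrite cycle1.
(* An element of [<[a]>] incomparable to the smaller twin [y] would force [<[y]> = <[x]>], with
   [<[a]>] as the common cyclic subgroup. *)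
have dom: {in <[a]>, forall u, cyc_comparable x u}.
  move=> u ua; have uG: u \in G by apply: subsetP ua; rewrite cycle_subG.
  rewrite -tw //; apply: contraR y_neq_x => nyu; apply/eqP.
  apply: (nested_twins_cycle_eq yG xG uG tw syx nyu _ ua).
  by apply: subsetP yx; rewrite cycle_subG.
apply: leq_trans (subset_leq_card Tx) _.
apply: proper_pcycle_leq_totient (dominated_cycle_pgroup x_neq1 a'x dom) xa a'x.
by rewrite pdiv_prime // order_gt1.
Qed.

End TwinClasses.

Theorem theorem4p3 (gT : finGroupType) (G : {group gT}) (a b : gT) (k : nat)
    (G_noncyclic : ~~ cyclic G) (aG : a \in G) (bG : b \in G) (a_neq_b : a != b)
    (ab_nonadj : ~~ power_graph G a b)
    (Na : twin_number G a = k) (Nb : twin_number G b = k) :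
  enhanced_power_graph G a b <->
  exists c : gT, [/\ c \in G, power_graph G a c, power_graph G b c &
                     k < twin_number G c].
Proof.
have nab: ~~ cyc_comparable a b.
  by move: ab_nonadj; rewrite power_graphE // a_neq_b.
have nba: ~~ cyc_comparable b a by rewrite cyc_comparableC.
rewrite twin_numberE // in Na; rewrite twin_numberE // in Nb.
split=> [/and4P[_ _ _ /exists_inP[d dG /andP[ad bd]]] | [c [cG ac bc lt_kc]]].
  have ka: k <= totient #[a].
    by rewrite -Na twins_leq_totient //; apply: twins_generate_cycle nab ad bd dG.
  have kb: k <= totient #[b].
    by rewrite -Nb twins_leq_totient //; apply: twins_generate_cycle nba bd ad dG.
  have cAB: <[b]> \subset 'C(<[a]>).
    by rewrite (sub_abelian_cent2 (cycle_abelian d)) ?cycle_subG.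
  have [c defc]: exists c, <[a]> <*> <[b]> = <[c]>.
    apply/cyclicP; apply: cyclicS (cycle_cyclic d).
    by rewrite join_subG !cycle_subG ad.
  have ac: a \in <[c]> by rewrite -defc -cycle_subG joing_subl.
  have bc: b \in <[c]> by rewrite -defc -cycle_subG joing_subr.
  have cG: c \in G by rewrite -cycle_subG -defc join_subG !cycle_subG aG.
  have neq u v : u \in <[c]> -> v \in <[c]> -> ~~ cyc_comparable u v ->
      #[u] != #[c].
    move=> uc vc; apply: contra => /eqP eq_uc.
    suff /eqP uEc: <[u]> == <[c]>.
      by rewrite /cyc_comparable uEc !cycle_subG vc orbT.
    by rewrite eqEcard cycle_subG uc -!orderE eq_uc /=.
  exists c; split=> //.
  - rewrite power_graphE // /cyc_comparable cycle_subG ac andbT.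
    by apply: contraNneq (neq a b ac bc nab) => ->.
  - rewrite power_graphE // /cyc_comparable cycle_subG bc andbT.
    by apply: contraNneq (neq b a bc ac nba) => ->.
  rewrite twin_numberE // ltnNge; apply/negP=> le_ck.
  have le_c := leq_trans (totient_leq_twins cG) le_ck.
  have /andP[odd_a even_c] := totient_proper_dvd (order_gt0 c) (order_dvdG ac)
    (neq a b ac bc nab) (leq_trans le_c ka).
  have /andP[odd_b _] := totient_proper_dvd (order_gt0 c) (order_dvdG bc)
    (neq b a bc ac nba) (leq_trans le_c kb).
  (* Parity clash: [#[a] * #[b]] is odd, yet equals [#[c]] times the order of the intersection. *)
  have := mul_cardG <[a]> <[b]>.
  rewrite -(cent_joinEr cAB) defc => /(congr1 odd).
  by rewrite !oddM -!orderE odd_a odd_b (negPf even_c).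
move: ac bc; rewrite !power_graphE // => /andP[_ ac] /andP[_ bc].
rewrite /enhanced_power_graph aG bG a_neq_b /=.
(* Only the case of [c] below both [a] and [b] needs the bound on N_c; the mixed cases would make
   [a] and [b] comparable. *)
case/orP: ac => [sac | sca]; case/orP: bc => [sbc | scb].
- by apply/exists_inP; exists c; rewrite // -!cycle_subG sac.
- by case/negP: nab; rewrite /cyc_comparable (subset_trans sac scb).
- by case/negP: nba; rewrite /cyc_comparable (subset_trans sbc sca).
apply: contraLR lt_kc; rewrite negb_exists_in => /forall_inP no_d.
rewrite -leqNgt twin_numberE // -Na.
by apply: (twins_leq_of_no_common_cycle aG bG) no_d; rewrite -?cycle_subG.
Qed.
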